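(* Let $\mathcal{P}=(\mathcal{S},\mathcal{F},\mathrm{val})$ be an optimization problem with completeness guarantee $C$ and soundness guarantee $S$, and let $M$ be its $(C,S)$-approximate slack matrix. Then \[ \mathrm{fc}(\mathcal{P},C,S)=\operatorname{rank}_{\mathrm{LP}} M \qquad\text{and}\qquad \mathrm{fc}_{+}(\mathcal{P},C,S)=\operatorname{rank}_{\mathrm{SDP}} M . \]
   Context: An optimization problem $\mathcal{P}=(\mathcal{S},\mathcal{F},\mathrm{val})$ consists of a set $\mathcal{S}$ of feasible solutions, a set $\mathcal{F}$ of instances and a function $\mathrm{val}\colon\mathcal{S}\times\mathcal{F}\to\mathbb{R}$, written $\mathrm{val}_f(s)$. It is declared to be either a maximization or a minimization problem. Guarantees are real functions $C$ (completeness) and $S$ (soundness) on $\mathcal{F}$, with $C(f)\ge S(f)$ for all $f$ in the maximization case and $C(f)\le S(f)$ in the minimization case. For a maximization problem let $\mathcal{F}^{\mathcal{S}}=\{f\in\mathcal{F}:\max_{s\in\mathcal{S}}\mathrm{val}_f(s)\le S(f)\}$. For a minimization problem let $\mathcal{F}^{\mathcal{S}}=\{f\in\mathcal{F}:\min_{s}\mathrm{val}_f(s)\ge S(f)\}$. A $(C,S)$-approximate LP formulation of $\mathcal{P}$ consists of: - a linear system $Ax\le b$ with $x\in\mathbb{R}^d$; - vectors $x^s\in\mathbb{R}^d$ ($s\in\mathcal{S}$) with $Ax^s\le b$; - affine functions $w^f\colon\mathbb{R}^d\to\mathbb{R}$ ($f\in\mathcal{F}^{\mathcal{S}}$) with $w^f(x^s)=\mathrm{val}_f(s)$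 for all $s\in\mathcal{S}$; - the requirement $\max\{w^f(x):Ax\le b\}\le C(f)$ for all $f\in\mathcal{F}^{\mathcal{S}}$ (for minimization problems: $\min\{w^f(x):Ax\le b\}\ge C(f)$). Its size is the number of inequalities in $Ax\le b$. $\mathrm{fc}(\mathcal{P},C,S)$ is the minimal size of such a formulation. A $(C,S)$-approximate SDP formulation consists of: - a linear map $\mathcal{A}\colon\mathbb{S}^d\to\mathbb{R}^k$ ($\mathbb{S}^d$ the real symmetric $d\times d$ matrices) and $b\in\mathbb{R}^k$; - matrices $X^s\in\mathbb{S}^d_+$ (positive semidefinite) with $\mathcal{A}(X^s)=b$; - affine functions $w^f\colon\mathbb{S}^d\to\mathbb{R}$ ($f\in\mathcal{F}^{\mathcal{S}}$) with $w^f(X^s)=\mathrm{val}_f(s)$; - the requirement $\sup\{w^f(X):X\in\mathbb{S}^d_+,\ \mathcal{A}(X)=b\}\le C(f)$ for all $f\in\mathcal{F}^{\mathcal{S}}$ (infimum $\ge C(f)$ for minimization). Its size is $d$. $\mathrm{fc}_+(\mathcal{P},C,S)$ is the minimal size of such a formulation. The $(C,S)$-approximate slack matrix of $\mathcal{P}$ is the $\mathcal{F}^{\mathcal{S}}\times\mathcal{S}$ matrix with entries $M(f,s)=C(f)-\mathrm{val}_f(s)$ (maximization) or $M(f,s)=\mathrm{val}_f(s)-C(f)$ (minimization); it is nonnegative. For a nonnegative $m\times n$ matrix $M$: - $\operatorname{rank}_{\mathrm{LP}}M$ is the minimal $r$ such that $M=TU+\mu\mathbb{1}$ with $T\in\mathbb{R}_+^{m\times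 r}$, $U\in\mathbb{R}_+^{r\times n}$, $\mu\in\mathbb{R}_+^{m\times 1}$, where $\mathbb{1}$ is the all-ones $1\times n$ matrix; - $\operatorname{rank}_{\mathrm{SDP}}M$ is the minimal $r$ such that there are $T_1,\dots,T_m,U_1,\dots,U_n\in\mathbb{S}^r_+$ and $\mu\in\mathbb{R}_+^m$ with $M_{ij}=\operatorname{tr}[T_iU_j]+\mu(i)$ for all $i,j$. *)

(* Defs.v *)
From HB Require Import structures.
From mathcomp Require Import all_boot all_order all_algebra.
From mathcomp Require Import boolp classical_sets reals constructive_ereal ereal.

Set Implicit Arguments.
Unset Strict Implicit.
Unset Printing Implicit Defensive.

Import Order.TTheory GRing.Theory Num.Theory.

Local Open Scope classical_set_scope.
Local Open Scope ring_scope.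

Lemma symmetricmxE (R : fieldType) (d : nat) (X : 'M[R]_d) :
  (X \is symmetricmx) = (X == X^T).
Proof. by rewrite qualifE /= expr0 scale1r map_mx_id. Qed.

Lemma symmetricmx_submod_closed (R : fieldType) (d : nat) :
  submod_closed [pred X : 'M[R]_d | X \is symmetricmx].
Proof.
split=> [|a X Y]; rewrite !inE !symmetricmxE ?trmx0// => /eqP XE /eqP YE.
by rewrite linearP /= -XE -YE.
Qed.

HB.instance Definition _ (R : fieldType) (d : nat) :=
  GRing.isSubmodClosed.Build R 'M[R]_d
    [pred X : 'M[R]_d | X \is symmetricmx] (@symmetricmx_submod_closed R d).

Section SymmetricMatrices.
Variables (R : fieldType) (d : nat).

(* The space S^d of symmetric matrices, as a vector space of its own. *)
Record symmx := SymMx {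
  symmx_val :> 'M[R]_d;
  _ : [pred X : 'M[R]_d | X \is symmetricmx] symmx_val }.

HB.instance Definition _ := [isSub for symmx_val].
HB.instance Definition _ := [Choice of symmx by <:].
HB.instance Definition _ := [SubChoice_isSubLmodule of symmx by <:].

End SymmetricMatrices.

Definition psd (R : realType) (d : nat) : set (symmx R d) :=
  [set X | forall u : 'cV[R]_d, 0 <= (u^T *m (X : 'M[R]_d) *m u) 0 0].

Definition affine (R : realType) (V : lmodType R) (w : V -> R) : Prop :=
  exists (l : {scalar V}) (c : R), forall x, w x = l x + c.

Inductive sense := Maximize | Minimize.

Record optProblem (R : realType) := OptProblem {
  sol : Type;
  inst : Type;
  objval : sol -> inst -> R;
  opt_sense : sense }.

Section Problem.
Variables (R : realType) (P : optProblem R).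
Local Open Scope ereal_scope.

(* The max (resp. min) of w over D whenever it is attained, in particular for a
   finite nonempty D or a feasible bounded linear program; otherwise the sup
   (resp. inf) in \bar R, so that an unbounded w has an infinite optimum. *)
Definition optimum (T : Type) (D : set T) (w : T -> R) : \bar R :=
  match opt_sense P with
  | Maximize => ereal_sup [set (w x)%:E | x in D]
  | Minimize => ereal_inf [set (w x)%:E | x in D]
  end.

(* The value x is no better than y with respect to the sense of P. *)
Definition no_better (x y : \bar R) : Prop :=
  match opt_sense P with
  | Maximize => x <= y
  | Minimize => y <= x
  end.

Definition guarantees (C S : inst P -> R) : Prop :=
  forall f, no_better (S f)%:E (C f)%:E.

(* The set F^S, also used as an index type through the coercion set_type. *)
Definition sound_inst (S : inst P -> R) : set (inst P) :=
  [set f | no_better (optimum setT (fun s : sol P => objval s f)) (S f)%:E].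

Definition slack_matrix (C S : inst P -> R) (f : sound_inst S) (s : sol P) : R :=
  match opt_sense P with
  | Maximize => (C (val f) - objval s (val f))%R
  | Minimize => (objval s (val f) - C (val f))%R
  end.

End Problem.

Arguments slack_matrix {R P} C S f s.

(* The least element of a set of natural numbers; +oo if the set is empty, which
   can happen when there are infinitely many solutions and instances. *)
Definition min_size (R : realType) (A : set nat) : \bar R :=
  ereal_inf [set (n%:R)%:E | n in A].

Definition polyhedron (R : realType) (m d : nat) (A : 'M[R]_(m, d)) (b : 'cV[R]_m)
    : set 'cV[R]_d :=
  [set x | forall i, (A *m x) i 0 <= b i 0].

Record LPformulation (R : realType) (P : optProblem R) (C S : inst P -> R)
    (m : nat) := LPFormulation {
  lp_dim : nat;
  lp_A : 'M[R]_(m, lp_dim);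
  lp_b : 'cV[R]_m;
  lp_sol : sol P -> 'cV[R]_lp_dim;
  lp_obj : sound_inst S -> 'cV[R]_lp_dim -> R;
  lp_sol_feasible : forall s, polyhedron lp_A lp_b (lp_sol s);
  lp_obj_affine : forall f, affine (lp_obj f);
  lp_obj_exact : forall f s, lp_obj f (lp_sol s) = objval s (val f);
  lp_obj_bound : forall f,
    no_better P (optimum P (polyhedron lp_A lp_b) (lp_obj f)) (C (val f))%:E }.

Definition fc (R : realType) (P : optProblem R) (C S : inst P -> R) : \bar R :=
  min_size R [set m | inhabited (LPformulation C S m)].

Definition spectrahedron (R : realType) (d k : nat)
    (A : {linear symmx R d -> 'cV[R]_k}) (b : 'cV[R]_k) : set (symmx R d) :=
  [set X | psd X /\ A X = b].

Record SDPformulation (R : realType) (P : optProblem R) (C S : inst P -> R)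
    (d : nat) := SDPFormulation {
  sdp_codim : nat;
  sdp_A : {linear symmx R d -> 'cV[R]_sdp_codim};
  sdp_b : 'cV[R]_sdp_codim;
  sdp_sol : sol P -> symmx R d;
  sdp_obj : sound_inst S -> symmx R d -> R;
  sdp_sol_feasible : forall s, spectrahedron sdp_A sdp_b (sdp_sol s);
  sdp_obj_affine : forall f, affine (sdp_obj f);
  sdp_obj_exact : forall f s, sdp_obj f (sdp_sol s) = objval s (val f);
  sdp_obj_bound : forall f,
    no_better P (optimum P (spectrahedron sdp_A sdp_b) (sdp_obj f))
      (C (val f))%:E }.

Definition fc_plus (R : realType) (P : optProblem R) (C S : inst P -> R) : \bar R :=
  min_size R [set d | inhabited (SDPformulation C S d)].

Section Ranks.
Variables (R : realType) (I J : Type).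
(* I and J index the rows and columns, and may be infinite. *)
Implicit Type M : I -> J -> R.

Definition LPfactorization M (r : nat) : Prop :=
  exists (T : I -> 'I_r -> R) (U : 'I_r -> J -> R) (mu : I -> R),
    [/\ forall i k, 0 <= T i k, forall k j, 0 <= U k j, forall i, 0 <= mu i
      & forall i j, M i j = \sum_(k < r) T i k * U k j + mu i].

Definition SDPfactorization M (r : nat) : Prop :=
  exists (T : I -> symmx R r) (U : J -> symmx R r) (mu : I -> R),
    [/\ forall i, psd (T i), forall j, psd (U j), forall i, 0 <= mu i
      & forall i j, M i j = \tr ((T i : 'M[R]_r) *m (U j : 'M[R]_r)) + mu i].

Definition rankLP M : \bar R := min_size R [set r | LPfactorization M r].

Definition rankSDP M : \bar R := min_size R [set r | SDPfactorization M r].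

End Ranks.

(* Main.v *)
From HB Require Import structures.
Require Import Defs.
From mathcomp Require Import all_boot all_order all_algebra.
From mathcomp Require Import boolp classical_sets reals constructive_ereal ereal.
From mathcomp Require Import ring lra.

(** A factorization of the slack matrix is a formulation over the nonnegative
    orthant (resp. the psd cone), its right factors being the solutions.
    Conversely, conic duality writes the slack of the objective of [f] as a dual
    vector [T f] paired with the conic slack of the feasible point, plus a constant
    [mu f >= 0]. Attainment of the dual needs a strictly feasible point,
    obtained by facial reduction: a feasible [x0] of maximal support (resp. a
    feasible [X0 = Q Q^T] of maximal rank) is strictly feasible once the implicit
    equalities are taken out (resp. once the problem is rewritten in the variable
    [Y], [X = Q Y Q^T], where [X0] becomes the identity). With such an order unit,
    duality is an algebraic Hahn-Banach theorem. *)

Set Implicit Arguments.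
Unset Strict Implicit.
Unset Printing Implicit Defensive.

Import Order.TTheory GRing.Theory Num.Theory.

Local Open Scope classical_set_scope.
Local Open Scope ring_scope.

(** Supplies feasible points of maximal support or rank with no compactness argument: the quantity
    maximized is a bounded natural number. *)
Lemma ex_argmax_nat (T : Type) (D : set T) (f : T -> nat) (n : nat) :
  D !=set0 -> (forall x, D x -> (f x <= n)%N) ->
  exists2 x, D x & forall y, D y -> (f y <= f x)%N.
Proof.
move=> [x0 Dx0] fn.
pose q k := `[< exists2 x, D x & f x = k >].
have q0 : exists k, q k by exists (f x0); apply/asboolP; exists x0.
have qn k : q k -> (k <= n)%N by move=> /asboolP[x Dx <-]; apply: fn.
case: (ex_maxnP q0 qn) => k /asboolP[x Dx <-] kmax.
by exists x => // y Dy; apply: kmax; apply/asboolP; exists y.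
Qed.

(** * Algebraic Hahn-Banach theorem and conic duality *)

Section HahnBanach.
Variables (R : realType) (E : lmodType R).
Implicit Types (p q : E -> R) (x y v : E).

(** One inequality of positive homogeneity suffices, since applying it to [t^-1] gives the other;
    infima are then easier to show sublinear. *)
Definition sublinear p : Prop :=
  (forall x y, p (x + y) <= p x + p y) /\
  (forall (t : R) x, 0 < t -> p (t *: x) <= t * p x).

Lemma sublinear0 p : sublinear p -> p 0 = 0.
Proof.
move=> [_ pZ]; have := pZ 2 0 ltac:(lra); have := pZ 2^-1 0 ltac:(lra).
by rewrite !scaler0; lra.
Qed.

Lemma sublinearZ p t x : sublinear p -> 0 <= t -> p (t *: x) = t * p x.
Proof.
move=> ps; rewrite le_eqVlt => /predU1P[<-|t0].
  by rewrite scale0r mul0r sublinear0.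
apply/eqP; rewrite eq_le ps.2//= -ler_pdivlMl//.
rewrite -{1}[x](scalerK (lt0r_neq0 t0)).
by apply: ps.2; rewrite invr_gt0.
Qed.

Lemma sublinearN_ge p x : sublinear p -> - p (- x) <= p x.
Proof. by move=> ps; have := ps.1 x (- x); rewrite subrr sublinear0//; lra. Qed.

(* Take [q x = inf_(t >= 0) (p (x + t v) - t p v)]. *)
Lemma sublinear_flatten p v : sublinear p ->
  exists q, [/\ sublinear q, forall x, q x <= p x & q (- v) <= - q v].
Proof.
move=> ps.
pose S x := [set p (x + t *: v) - t * p v | t in [set t | 0 <= t]].
have S_lb x : lbound (S x) (- p (- x)).
  move=> _ [t t0 <-]; have := ps.1 (x + t *: v) (- x).
  by rewrite addrC addKr sublinearZ//; lra.
have S_ge x r : S x r -> inf (S x) <= r.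
  by move=> Sr; apply: ge_inf => //; exists (- p (- x)); exact: S_lb.
have S_ne x : S x !=set0.
  by exists (p (x + 0 *: v) - 0 * p v); exists 0 => //=.
exists (fun x => inf (S x)); split=> [|x|].
- split=> [x y|t x t0].
    rewrite -lerBlDr; apply: lb_le_inf => // _ [t /= t0 <-].
    rewrite lerBlDr -lerBlDl; apply: lb_le_inf => // _ [s /= s0 <-].
    have := ps.1 (x + t *: v) (y + s *: v); rewrite addrACA -scalerDl => h.
    have /= := S_ge (x + y) (p (x + y + (t + s) *: v) - (t + s) * p v).
    move=> /(_ ltac:(by exists (t + s) => //=; lra)); lra.
  rewrite -ler_pdivrMl//; apply: lb_le_inf => // _ [s /= s0 <-].
  rewrite ler_pdivrMl//.
  have := ps.2 t (x + s *: v) t0; rewrite scalerDr scalerA => h.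
  have := S_ge (t *: x) (p (t *: x + (t * s) *: v) - (t * s) * p v).
  move=> /(_ ltac:(by exists (t * s) => //=; rewrite mulr_ge0// ltW)); lra.
- by apply: S_ge; exists 0 => //=; rewrite scale0r addr0 mul0r subr0.
(* With [q] the new functional, [t = 0] gives [q v <= p v], and [t = 1] gives
   [q (- v) <= p 0 - p v = - p v]. *)
- have h1 : inf (S v) <= p v.
    by apply: S_ge; exists 0 => //=; rewrite scale0r addr0 mul0r subr0.
  have h2 : inf (S (- v)) <= - p v.
    apply: S_ge; exists 1 => //=.
    by rewrite scale1r addNr sublinear0// mul1r sub0r.
  lra.
Qed.

(** Decreasing a functional preserves [q (- v) <= - q v], so vectors can be flattened one after
    another. *)
Lemma sublinear_flatten_seq p (s : seq E) : sublinear p ->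
  exists q, [/\ sublinear q, forall x, q x <= p x
    & forall v, v \in s -> q (- v) <= - q v].
Proof.
move=> ps; elim: s => [|v s [q [qs qp qN]]]; first by exists p.
have [r [rs rq rN]] := sublinear_flatten v qs.
exists r; split=> // [x|u]; first exact: le_trans (rq x) (qp x).
rewrite inE => /predU1P[->//|/qN uN].
by have := rq (- u); have := rq u; lra.
Qed.

(** The finite spanning family replaces Zorn's lemma. Once flattened on the generators, the
    functional is odd on their multiples, hence by subadditivity on all of [E], and an odd sublinear
    functional is linear. *)
Lemma finite_hahn_banach (I : finType) (e : I -> E) p :
  (forall y, exists c : I -> R, y = \sum_i c i *: e i) -> sublinear p ->
  exists phi : {scalar E}, forall y, phi y <= p y.
Proof.
move=> espan ps.
have [q [qs qp qN]] := sublinear_flatten_seq [seq e i | i <- enum I] ps.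
have {}qN y : q (- y) = - q y.
  apply/eqP; rewrite eq_le; apply/andP; split; last first.
    by rewrite -[leRHS]opprK lerN2; have := sublinearN_ge (- y) qs; rewrite opprK; lra.
  have [c ->] := espan y.
  apply: (big_ind (fun y => q (- y) <= - q y)) => [|u v hu hv|i _].
  - by rewrite oppr0 sublinear0// oppr0.
  - by have := qs.1 u v; have := qs.1 (- u) (- v); rewrite -opprD; lra.
  - have ei : q (- e i) <= - q (e i) by apply: qN; rewrite map_f ?mem_enum.
    have [c0|c0] := leP 0 (c i).
      by rewrite -scalerN !sublinearZ// -mulrN ler_wpM2l.
    have ci : 0 <= - c i by lra.
    rewrite -scaleNr sublinearZ// -[c i in leRHS]opprK scaleNr -scalerN.
    by rewrite sublinearZ// -mulrN ler_wpM2l//; lra.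
have qlin : scalar q.
  have qD x y : q (x + y) = q x + q y.
    apply/eqP; rewrite eq_le qs.1 /=.
    by have := qs.1 (- x) (- y); rewrite -opprD !qN; lra.
  move=> a x y; rewrite qD; congr (_ + _).
  have [a0|a0] := leP 0 a; first exact: sublinearZ.
  by rewrite -[a]opprK scaleNr qN sublinearZ ?mulNr//; lra.
pose qL := GRing.isLinear.Build R E R *%R q qlin.
pose phi : {scalar E} := HB.pack q qL.
by exists phi.
Qed.

(* [N] is a subspace of [E * R], the graph of the prescribed values of [phi]. The
   dominating functional is [y |-> inf {t g + r | t e + z - y \in K}] over
   [t >= 0] and [(z, r) \in N]. *)
Lemma cone_duality (I : finType) (b : I -> E) (K : set E) (N : set (E * R))
    (e : E) (g : R) :
  (forall y, exists c : I -> R, y = \sum_i c i *: b i) ->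
  (forall x y, K x -> K y -> K (x + y)) ->
  (forall (t : R) x, 0 <= t -> K x -> K (t *: x)) ->
  N (0, 0) ->
  (forall a z r z' r', N (z, r) -> N (z', r') -> N (a *: z + z', a * r + r')) ->
  (forall y, exists2 t : R, 0 < t & K (t *: e + y)) ->
  (forall z r, N (z, r) -> K (e + z) -> 0 <= g + r) ->
  exists phi : {scalar E}, [/\ forall y, K y -> 0 <= phi y, phi e <= g
    & forall z r, N (z, r) -> phi z = r].
Proof.
move=> bspan KD KZ N0 Nlin eunit gN.
have K0 : K 0 by have [t _ /KZ-/(_ 0 (lexx _))] := eunit 0; rewrite scale0r.
have NZ a z r : N (z, r) -> N (a *: z, a * r).
  by move=> Nz; have := Nlin a _ _ _ _ Nz N0; rewrite !addr0.
have ND z r z' r' : N (z, r) -> N (z', r') -> N (z + z', r + r').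
  by move=> Nz Nz'; have := Nlin 1 _ _ _ _ Nz Nz'; rewrite scale1r mul1r.
pose S y := [set a | exists t z r,
  [/\ 0 <= t, N (z, r), K (t *: e + z - y) & a = t * g + r]].
have key t z r : 0 < t -> N (z, r) -> K (t *: e + z) -> 0 <= t * g + r.
  move=> t0 Nz /KZ-/(_ t^-1); rewrite invr_ge0 ltW// => /(_ isT).
  rewrite scalerDr scalerK ?lt0r_neq0// => /gN-/(_ (t^-1 * r) (NZ _ _ _ Nz)).
  by move/(mulr_ge0 (ltW t0)); rewrite mulrDr mulVKf// lt0r_neq0.
have S_lb y : exists m, lbound (S y) m.
  (* Adding [s e + y] to [t e + z - y] cancels [y] and leaves the scale [t + s], positive even when
     [t = 0], as [key] requires. *)
  have [s s0 Ks] := eunit y; exists (- (s * g)) => _ [t [z [r [t0 Nz Kz ->]]]].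
  have /(key (t + s) z r ltac:(lra) Nz) : K ((t + s) *: e + z).
    by have := KD _ _ Kz Ks; rewrite addrACA addNr addr0 scalerDl addrAC.
  lra.
have S_ge y a : S y a -> inf (S y) <= a.
  by move=> Sa; apply: ge_inf => //; exact: S_lb.
have S_ne y : S y !=set0.
  have [t t0 Kt] := eunit (- y); exists (t * g + 0), t, 0, 0.
  by rewrite addr0; split=> //; lra.
have [|phi phip] := finite_hahn_banach (p := fun y => inf (S y)) bspan.
  split=> [x y|t x t0].
    rewrite -lerBlDr; apply: lb_le_inf => // _ [t [z [r [t0 Nz Kz ->]]]].
    rewrite lerBlDr -lerBlDl; apply: lb_le_inf => // _ [s [z' [r' [s0 Nz' Kz' ->]]]].
    rewrite lerBlDl; apply: S_ge.
    exists (t + s), (z + z'), (r + r'); split; [lra|exact: ND| |lra].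
    by have := KD _ _ Kz Kz'; rewrite addrACA -opprD addrACA -scalerDl.
  rewrite -ler_pdivrMl//; apply: lb_le_inf => // _ [s [z [r [s0 Nz Kz ->]]]].
  rewrite ler_pdivrMl//; apply: S_ge; exists (t * s), (t *: z), (t * r).
  split; [by rewrite mulr_ge0// ltW|exact: NZ| |lra].
  by have := KZ _ _ (ltW t0) Kz; rewrite scalerBr scalerDr scalerA.
(* The triples [(t, z, r)] equal to [(0, 0, 0)], [(1, 0, 0)] and [(0, u, a)] put [0] in [S (- y)],
   [g] in [S e] and [a] in [S u]. Closure of [N] under negation turns the last bound into an
   equality. *)
exists phi; split=> [y Ky||z r Nz].
- rewrite -oppr_le0 -linearN; apply: le_trans (phip _) _.
  apply: S_ge; exists 0, 0, 0.
  by split=> //; rewrite ?scale0r ?addr0 ?sub0r ?opprK// mul0r.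
- apply: le_trans (phip _) _; apply: S_ge; exists 1, 0, 0; split=> //.
    by rewrite scale1r addr0 subrr.
  by rewrite mul1r addr0.
- have phi_le u a : N (u, a) -> phi u <= a.
    move=> Nu; apply: le_trans (phip _) _; apply: S_ge; exists 0, u, a.
    by split=> //; rewrite ?scale0r ?add0r ?subrr// mul0r add0r.
  apply/eqP; rewrite eq_le phi_le//=.
  have := phi_le _ _ (NZ (-1) _ _ Nz); rewrite scaleN1r linearN; lra.
Qed.

End HahnBanach.

(** * Linear programming duality *)

Lemma cV_sum_delta (R : realType) (m : nat) (y : 'cV[R]_m) :
  y = \sum_i y i 0 *: delta_mx i 0.
Proof.
by rewrite {1}[y]matrix_sum_delta; apply: eq_bigr => i _; rewrite big_ord1.
Qed.

Section LPDuality.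
Variables (R : realType) (m d : nat) (A : 'M[R]_(m, d)) (b : 'cV[R]_m).
Implicit Types x : 'cV[R]_d.

Lemma polyhedron_slack_ge0 x : polyhedron A b x -> forall i, 0 <= (b - A *m x) i 0.
Proof. by move=> xP i; rewrite !mxE subr_ge0; have := xP i; rewrite mxE. Qed.

Lemma polyhedronP x : (forall i, 0 <= (b - A *m x) i 0) -> polyhedron A b x.
Proof.
by move=> h i; have := h i; rewrite [X in 0 <= X]mxE [X in _ + X]mxE subr_ge0.
Qed.

(** The slack at the midpoint of two feasible points is supported on the union of their supports, so
    a maximal support contains all others. *)
Lemma polyhedron_max_support : polyhedron A b !=set0 ->
  exists2 x0, polyhedron A b x0 & forall x, polyhedron A b x ->
    forall i, (b - A *m x0) i 0 = 0 -> (b - A *m x) i 0 = 0.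
Proof.
move=> Pne; pose supp x := [set i | (b - A *m x) i 0 != 0]%SET.
have [x0 x0P x0max] := ex_argmax_nat (f := fun x => #|supp x|) Pne
  (fun x _ => max_card (mem (supp x))).
exists x0 => // x xP i e0; apply/eqP/negPn/negP => si.
have sE : b - A *m (2^-1 *: (x0 + x)) = 2^-1 *: ((b - A *m x0) + (b - A *m x)).
  rewrite -scalemxAr mulmxDr addrACA -opprD scalerBr; congr (_ - _).
  by rewrite -mulr2n -scaler_nat scalerA mulVf ?scale1r// pnatr_eq0.
have e_ge := polyhedron_slack_ge0 x0P; have s_ge := polyhedron_slack_ge0 xP.
have yP : polyhedron A b (2^-1 *: (x0 + x)).
  apply: polyhedronP => j; rewrite sE [X in 0 <= X]mxE [X in _ * X]mxE.
  by have := e_ge j; have := s_ge j; lra.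
have := x0max _ yP; apply/negP; rewrite -ltnNge; apply: proper_card.
apply/properP; split; last first.
  exists i; rewrite inE ?e0 ?eqxx// sE [X in X != 0]mxE [X in _ * X]mxE e0 add0r.
  by rewrite mulf_neq0// invr_eq0 pnatr_eq0.
apply/fintype.subsetP => j; rewrite !inE sE => ej.
rewrite [X in X != 0]mxE [X in _ * X]mxE mulf_neq0// ?invr_eq0 ?pnatr_eq0//.
by rewrite gt_eqF// ltr_wpDr// lt_def ej e_ge.
Qed.

Lemma lp_duality (w : 'cV[R]_d -> R) (c : R) : polyhedron A b !=set0 ->
  affine w -> (forall x, polyhedron A b x -> w x <= c) ->
  exists (T : 'I_m -> R) (mu : R), [/\ forall i, 0 <= T i, 0 <= mu &
    forall x, polyhedron A b x -> c - w x = \sum_i T i * (b - A *m x) i 0 + mu].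
Proof.
move=> /polyhedron_max_support[x0 x0P x0max] [l [a wE]] wc.
set e := b - A *m x0 in x0max; have e_ge := polyhedron_slack_ge0 x0P.
(* [K] ignores the implicit equalities, which makes [e] an order unit. [N] pairs the slack change
   with the opposite of the objective change along directions [h] that keep these equalities;
   [e + z] in [K] then means that [x0 + h] is feasible. *)
pose K := [set y : 'cV[R]_m | forall i, 0 < e i 0 -> 0 <= y i 0].
pose N := [set zr : 'cV[R]_m * R | exists h,
  [/\ forall i, e i 0 = 0 -> (A *m h) i 0 = 0, zr.1 = - (A *m h) & zr.2 = - l h]].
have [||||||z r|phi [phiK phie phiN]] := cone_duality
   (b := fun i : 'I_m => delta_mx i 0) (K := K) (N := N) (e := e) (g := c - w x0).
- by move=> y; exists (fun i => y i 0); exact: cV_sum_delta.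
- by move=> x y Kx Ky i ei; rewrite mxE addr_ge0 ?Kx ?Ky.
- by move=> t x t0 Kx i ei; rewrite mxE mulr_ge0 ?Kx.
- by exists 0; split=> /= [i _||]; rewrite ?mulmx0 ?linear0 ?oppr0// mxE.
- move=> t z r z' r' [h /= [h0 -> ->]] [h' /= [h'0 -> ->]]; exists (t *: h + h').
  split=> /= [i ei||].
  + by rewrite mulmxDr -scalemxAr [LHS]mxE [X in X + _]mxE h0// h'0// mulr0 addr0.
  + by rewrite mulmxDr -scalemxAr opprD scalerN.
  + by rewrite linearP /= opprD mulrN.
(* Coordinates with [e i 0 = 0] contribute [0] to the sum, as [0^-1 = 0], and [K] puts no condition
   on them. *)
- move=> y; exists (1 + \sum_i `|y i 0| / e i 0) => [|i ei].
    by rewrite ltr_pwDl// sumr_ge0// => i _; rewrite divr_ge0.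
  rewrite [X in _ <= X]mxE [X in X + _]mxE.
  suff : `|y i 0| <= (1 + \sum_i `|y i 0| / e i 0) * e i 0.
    by have := ler_norm (- y i 0); rewrite normrN; lra.
  rewrite -ler_pdivrMr// (bigD1 i)//= addrCA ler_wpDr// addr_ge0// sumr_ge0// => j _.
  by rewrite divr_ge0.
- move=> [h /= [h0 -> ->]] Kh.
  have := wc (x0 + h); rewrite !wE linearD /= => bound.
  suff /bound : polyhedron A b (x0 + h) by lra.
  apply: polyhedronP => i; rewrite mulmxDr opprD addrA -/e.
  have [e0|e0] := eqVneq (e i 0) 0.
    by rewrite [X in 0 <= X]mxE e0 [X in _ + X]mxE h0// oppr0 addr0.
  by apply: Kh; rewrite lt_def e0 e_ge.
exists (fun i => phi (delta_mx i 0)), (c - w x0 - phi e); split=> [i||x xP].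
- by apply: phiK => j _; rewrite mxE ler0n.
- by rewrite subr_ge0.
(* Maximality of the support of [x0] makes [x - x0] one of the directions allowed in [N]. *)
have /phiN phih : N (- (A *m (x - x0)), - l (x - x0)).
  exists (x - x0); split=> //= i ei; move: (x0max _ xP i ei).
  have -> : A *m (x - x0) = e - (b - A *m x).
    by rewrite mulmxBr /e opprB [RHS]addrC addrA subrK.
  by move=> sx; rewrite [LHS]mxE [X in _ + X]mxE sx ei oppr0 addr0.
have <- : phi (b - A *m x) = \sum_i phi (delta_mx i 0) * (b - A *m x) i 0.
  rewrite [X in phi X]cV_sum_delta linear_sum; apply: eq_bigr => i _.
  by rewrite linearZ /= mulrC.
have -> : b - A *m x = e - A *m (x - x0).
  by rewrite mulmxBr /e opprB addrA subrK.
rewrite linearD /= phih !wE linearB /=; lra.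
Qed.

End LPDuality.

(** * Quadratic forms and Gram factorization of psd matrices *)

Section PSDMatrices.
Variable R : realType.

Definition quad (n : nat) (X : 'M[R]_n) (u : 'cV[R]_n) : R := (u^T *m X *m u) 0 0.

Lemma quadD n (X Y : 'M[R]_n) u : quad (X + Y) u = quad X u + quad Y u.
Proof. by rewrite /quad mulmxDr mulmxDl mxE. Qed.

Lemma quadZ n t (X : 'M[R]_n) u : quad (t *: X) u = t * quad X u.
Proof. by rewrite /quad -scalemxAr -scalemxAl mxE. Qed.

Lemma quadE n (X : 'M[R]_n) u : quad X u = \sum_i \sum_j X i j * (u i 0 * u j 0).
Proof.
rewrite /quad mxE exchange_big /=; apply: eq_bigr => j _.
by rewrite mxE big_distrl; apply: eq_bigr => i _ /=; rewrite mxE; ring.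
Qed.

Lemma quad_congr m n (Q : 'M[R]_(n, m)) (X : 'M[R]_m) u :
  quad (Q *m X *m Q^T) u = quad X (Q^T *m u).
Proof. by rewrite /quad trmx_mul trmxK !mulmxA. Qed.

Lemma quad1 n (u : 'cV[R]_n) : quad 1%:M u = \sum_i u i 0 ^+ 2.
Proof. by rewrite /quad mulmx1 mxE; apply: eq_bigr => i _; rewrite mxE. Qed.

Lemma quad1_eq0 n (u : 'cV[R]_n) : quad 1%:M u = 0 -> u = 0.
Proof.
rewrite quad1 => /eqP; rewrite psumr_eq0 => [/allP h|i _]; last exact: sqr_ge0.
apply/matrixP => i j; rewrite ord1 mxE; apply/eqP.
by rewrite -sqrf_eq0; apply: (implyP (h i _)); rewrite ?mem_index_enum.
Qed.

Lemma quad_gram m n (Q : 'M[R]_(n, m)) u :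
  quad (Q *m Q^T) u = quad 1%:M (Q^T *m u).
Proof. by rewrite -quad_congr mulmx1. Qed.

Lemma quad_block n (a : R) (v : 'cV[R]_n) (B : 'M[R]_n) (s : R) u :
  quad (block_mx a%:M v^T v B : 'M_(1 + n)) (col_mx s%:M u) =
  a * s ^+ 2 + (2 * s * (u^T *m v) 0 0 + quad B u).
Proof.
rewrite /quad tr_col_mx tr_scalar_mx mul_row_block mul_row_col !mulmxDl.
rewrite -!scalar_mxM mul_mx_scalar mul_scalar_mx -scalemxAl.
have -> : v^T *m u = u^T *m v.
  apply/matrixP => i j; rewrite !ord1 !mxE.
  by apply: eq_bigr => k _; rewrite !mxE mulrC.
move: (u^T *m v) (u^T *m B *m u) => p q; rewrite !mxE !eqxx !mulr1n; ring.
Qed.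

(* Cholesky factorization: the pivot [a] may vanish, in which case so does the
   column [v] below it and the junk value [0^-1 = 0] gives the right factor. *)
Lemma psd_mx_gram n (X : 'M[R]_n) : X^T = X -> (forall u, 0 <= quad X u) ->
  exists Q : 'M[R]_n, X = Q *m Q^T.
Proof.
elim: n X => [|n IHn] X.
  by move=> _ _; exists 0; rewrite [LHS]flatmx0 [RHS]flatmx0.
rewrite -[n.+1]/(1 + n)%N in X *.
rewrite -[X]submxK; set v := dlsubmx X; set B := drsubmx X.
rewrite [ulsubmx X]mx11_scalar; set a := ulsubmx X 0 0.
rewrite tr_block_mx => /eq_block_mx[_ vE _ BE]; rewrite -{}vE => Xpsd.
have {Xpsd}qX s u : 0 <= a * s ^+ 2 + (2 * s * (u^T *m v) 0 0 + quad B u).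
  by rewrite -quad_block.
clearbody v B a; have a_ge0 : 0 <= a.
  by have := qX 1 0; rewrite /quad trmx0 !mul0mx mxE; lra.
have v0 : a = 0 -> v = 0.
  move=> a0; apply/matrixP => i j; rewrite ord1 mxE; apply/eqP/negPn/negP => vi.
  pose q := quad B (delta_mx i 0).
  (* With [a = 0] the form is affine in [s]; this [s] gives it the value [-1]. *)
  have := qX (- (q + 1) / (2 * v i 0)) (delta_mx i 0).
  rewrite a0 mul0r add0r trmx_delta -rowE [row _ _ _ _]mxE -/q.
  by rewrite [X in X + _](_ : _ = - (q + 1)); [lra|field].
pose w := (Num.sqrt a)^-1 *: v.
have vE : v = Num.sqrt a *: w.
  have [/v0 v0'|a0] := eqVneq a 0; first by rewrite /w v0' !scaler0.
  by rewrite scalerA mulfV ?scale1r// sqrtr_eq0 -ltNge lt_def a0.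
have [|u|Q' Q'E] := IHn (B - w *m w^T).
- by rewrite linearB /= trmx_mul trmxK BE.
- rewrite quadD -scaleN1r quadZ quad_gram quad1 big_ord1.
  set p := (u^T *m w) 0 0.
  have -> : (w^T *m u) 0 0 = p.
    by rewrite /p -[u in LHS]trmxK -trmx_mul mxE.
  (* When [a] is nonzero, this [s] minimizes the quadratic in [s], whose minimum [quad B u - p ^+ 2]
     is the form of the Schur complement. *)
  have := qX (- (Num.sqrt a)^-1 * p) u.
  rewrite vE -scalemxAr [X in 2 * _ * X]mxE -/p.
  have [a0|a0] := eqVneq a 0.
    have -> : p = 0 by rewrite /p /w v0// scaler0 mulmx0 mxE.
    by rewrite !mulr0; lra.
  rewrite -{1}(sqr_sqrtr a_ge0).
  have : Num.sqrt a != 0 by rewrite sqrtr_eq0 -ltNge lt_def a0.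
  move: (Num.sqrt a) => r r0.
  by rewrite [X in X + _](_ : _ = p ^+ 2) ?[X in _ + (X + _)](_ : _ = - 2 * p ^+ 2);
    [lra|field|field].
exists (block_mx (Num.sqrt a)%:M 0 w Q').
rewrite tr_block_mx mulmx_block !trmx0 tr_scalar_mx !mulmx0 !mul0mx !addr0.
rewrite -scalar_mxM -expr2 sqr_sqrtr// mul_scalar_mx mul_mx_scalar -vE.
by rewrite -Q'E addrC subrK -linearZ /= -vE.
Qed.

End PSDMatrices.

Lemma col_mulmx (R : pzSemiRingType) m n p (A : 'M[R]_(m, n)) (B : 'M[R]_(n, p)) j :
  col j (A *m B) = A *m col j B.
Proof. by rewrite !colE mulmxA. Qed.

(** * The psd cone in the space of symmetric matrices *)

Section SDPDuality.
Variable R : realType.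
Implicit Types d k : nat.

Lemma symmx_tr d (X : symmx R d) : (X : 'M[R]_d)^T = X.
Proof. by case: X => X /= XP; apply/esym/eqP; rewrite -symmetricmxE. Qed.

Lemma symmx_subproof d (X : 'M[R]_d) : X^T = X ->
  [pred X : 'M[R]_d | X \is symmetricmx] X.
Proof. by move=> XE; rewrite inE symmetricmxE XE. Qed.

Definition to_symmx d (X : 'M[R]_d) (XE : X^T = X) : symmx R d :=
  SymMx (symmx_subproof XE).

Lemma psd_gram d (X : symmx R d) : psd X -> exists Q : 'M[R]_d, X = Q *m Q^T :> 'M_d.
Proof. exact/psd_mx_gram/symmx_tr. Qed.

Lemma congr_subproof m n (Q : 'M[R]_(n, m)) (X : symmx R m) :
  (Q *m X *m Q^T)^T = Q *m X *m Q^T.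
Proof. by rewrite !trmx_mul trmxK symmx_tr mulmxA. Qed.

Definition congr_symmx m n (Q : 'M[R]_(n, m)) (X : symmx R m) : symmx R n :=
  to_symmx (congr_subproof Q X).

Lemma congr_symmx_is_linear m n (Q : 'M[R]_(n, m)) : linear (congr_symmx Q).
Proof.
move=> a X Y; apply: val_inj => /=.
by rewrite mulmxDr mulmxDl -scalemxAr -scalemxAl.
Qed.

HB.instance Definition _ m n (Q : 'M[R]_(n, m)) :=
  GRing.isLinear.Build R (symmx R m) (symmx R n) *:%R (congr_symmx Q)
    (congr_symmx_is_linear Q).

Lemma psd_congr m n (Q : 'M[R]_(n, m)) (X : symmx R m) :
  psd X -> psd (congr_symmx Q X).
Proof. by move=> Xpsd u; rewrite -/(quad _ _) quad_congr; exact: Xpsd. Qed.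

Definition symmx1 d : symmx R d := to_symmx (tr_scalar_mx d 1).

Lemma psdD d (X Y : symmx R d) : psd X -> psd Y -> psd (X + Y).
Proof. by move=> Xp Yp u; rewrite -/(quad _ _) quadD addr_ge0 ?Xp ?Yp. Qed.

Lemma psdZ d (t : R) (X : symmx R d) : 0 <= t -> psd X -> psd (t *: X).
Proof. by move=> t0 Xp u; rewrite -/(quad _ _) quadZ mulr_ge0 ?Xp. Qed.

(** Writing [Y = Q Q^T], the trace becomes that of [Q^T X Q], whose diagonal entries are values of
    the form of [X] at the columns of [Q]. *)
Lemma trace_psd_ge0 d (X Y : symmx R d) : psd X -> psd Y ->
  0 <= \tr ((X : 'M[R]_d) *m (Y : 'M[R]_d)).
Proof.
move=> Xp /psd_gram[Q ->]; rewrite mulmxA mxtrace_mulC /mxtrace sumr_ge0// => i _.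
suff -> : (Q^T *m ((X : 'M_d) *m Q)) i i = quad X (col i Q) by exact: Xp.
rewrite /quad -mulmxA -col_mulmx; move: ((X : 'M_d) *m Q) => XQ.
by rewrite !mxE; apply: eq_bigr => j _; rewrite !mxE.
Qed.

(** The identity is an order unit: each [|u i * u j|] is at most the squared norm of [u], so the sum
    of the [|Y i j|] outweighs the form of [Y]. The extra [1] keeps [t] positive. *)
Lemma psd_unit d (Y : symmx R d) : exists2 t : R, 0 < t & psd (t *: symmx1 d + Y).
Proof.
exists (1 + \sum_i \sum_j `|(Y : 'M_d) i j|) => [|u].
  by rewrite ltr_pwDl// sumr_ge0// => i _; rewrite sumr_ge0.
rewrite -/(quad _ _) quadD quadZ quad1 mulrDl mul1r.
set N := \sum_i _ ^+ 2; have N0 : 0 <= N by rewrite sumr_ge0// => i _; rewrite sqr_ge0.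
rewrite -addrA addr_ge0// quadE mulr_suml -big_split sumr_ge0// => i _ /=.
rewrite mulr_suml -big_split sumr_ge0// => j _ /=.
have uN h : u h 0 ^+ 2 <= N.
  by rewrite /N (bigD1 h)//= lerDl sumr_ge0// => l _; rewrite sqr_ge0.
have uuN : `|u i 0 * u j 0| <= N.
  have := uN i; have := uN j; rewrite ler_norml.
  by have := sqr_ge0 (u i 0 + u j 0); have := sqr_ge0 (u i 0 - u j 0); nra.
have := ler_wpM2l (normr_ge0 ((Y : 'M_d) i j)) uuN; rewrite -normrM.
by have := ler_norm (- ((Y : 'M_d) i j * (u i 0 * u j 0))); rewrite normrN; lra.
Qed.

(** On each column [z] of [Z] two nonnegative forms sum to zero, so both vanish; with [X = Q Q^T],
    the form of [X] is the squared norm of [Q^T z]. *)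
Lemma psdD_mulmx_eq0 d n (X Y : symmx R d) (Z : 'M[R]_(d, n)) : psd X -> psd Y ->
  ((X : 'M_d) + (Y : 'M_d)) *m Z = 0 -> (X : 'M_d) *m Z = 0.
Proof.
move=> Xp Yp XYZ; have [Q QE] := psd_gram Xp.
rewrite QE -mulmxA; suff -> : Q^T *m Z = 0 by rewrite mulmx0.
apply/matrixP => i j; rewrite [RHS]mxE.
have : Q^T *m col j Z = 0.
  apply: quad1_eq0; rewrite -quad_gram -QE.
  have := Xp (col j Z); have := Yp (col j Z); rewrite -!/(quad _ _).
  suff : quad ((X : 'M_d) + (Y : 'M_d)) (col j Z) = 0 by rewrite quadD; lra.
  by rewrite /quad -mulmxA -col_mulmx XYZ col0 mulmx0 mxE.
by move/matrixP/(_ i 0); rewrite -col_mulmx !mxE.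
Qed.

(** * Facial reduction of spectrahedra *)

Section FacialReduction.
Variables (d k : nat) (A : {linear symmx R d -> 'cV[R]_k}) (b : 'cV[R]_k).

(** The row space of the midpoint [Z] contains those of [X0] and [X]; as its rank cannot exceed that
    of [X0], it equals the row space of [X0]. *)
Lemma spectrahedron_max_rank : spectrahedron A b !=set0 ->
  exists2 X0, spectrahedron A b X0 &
    forall X, spectrahedron A b X -> ((X : 'M_d) <= (X0 : 'M_d))%MS.
Proof.
move=> Sne; have [X0 X0S X0max] := ex_argmax_nat (f := fun X : symmx R d => \rank X)
  Sne (fun X _ => rank_leq_row X).
exists X0 => // X XS; case: (X0S) (XS) => X0p AX0 [Xp AX].
pose Z := 2^-1 *: (X0 + X).
have ZS : spectrahedron A b Z.
  split; first by apply: psdZ; [rewrite invr_ge0|exact: psdD].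
  rewrite linearZ linearD /= AX0 AX.
  by rewrite -mulr2n -scaler_nat scalerA mulVf ?scale1r// pnatr_eq0.
have Zker : ((X0 : 'M_d) + (X : 'M_d)) *m cokermx (Z : 'M_d) = 0.
  have : (Z : 'M_d) *m cokermx (Z : 'M_d) = 0 by exact: mulmx_coker.
  rewrite {1}/Z /= -scalemxAl => /eqP; rewrite scaler_eq0 invr_eq0 pnatr_eq0 /=.
  by move/eqP.
have X0Z : ((X0 : 'M_d) <= (Z : 'M_d))%MS.
  by rewrite submxE; apply/eqP; apply: psdD_mulmx_eq0 X0p Xp Zker.
have XZ : ((X : 'M_d) <= (Z : 'M_d))%MS.
  by rewrite submxE; apply/eqP; apply: psdD_mulmx_eq0 Xp X0p _; rewrite addrC.
apply: submx_trans XZ _.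
by rewrite -(geq_leqif (mxrank_leqif_sup X0Z)) X0max.
Qed.

(** [Q] is kept square, possibly singular, so that the reduced problem still has size [d]. [N] is a
    generalized inverse of [Q]: the columns of each feasible [X] lie in the range of [Q], hence
    [Q N X = X]. *)
Lemma facial_reduction : spectrahedron A b !=set0 ->
  exists Q N : 'M[R]_d, A (congr_symmx Q (symmx1 d)) = b /\
    forall X, spectrahedron A b X -> X = congr_symmx Q (congr_symmx N X).
Proof.
move=> /spectrahedron_max_rank[X0 [X0p AX0] X0max].
have [Q QE] := psd_gram X0p; exists Q, (pinvmx Q^T)^T; split.
  by rewrite -AX0; congr (A _); apply: val_inj; rewrite /= mulmx1.
move=> X /X0max XX0; have XQ : ((X : 'M_d) <= Q^T)%MS.
  by apply: submx_trans XX0 _; rewrite QE submxMl.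
have := mulmxKpV XQ; move: (pinvmx _) => N XE.
have XE' : Q *m N^T *m X = X.
  by have := congr1 trmx XE; rewrite !trmx_mul trmxK symmx_tr mulmxA.
apply: val_inj; rewrite /= trmxK.
by rewrite !mulmxA XE' XE.
Qed.

End FacialReduction.

(** * Trace duality and semidefinite programming duality *)

Lemma symmx_delta_subproof d (i j : 'I_d) :
  (2^-1 *: (delta_mx i j + delta_mx j i))^T = 2^-1 *: (delta_mx i j + delta_mx j i)
  :> 'M[R]_d.
Proof. by rewrite linearZ linearD /= !trmx_delta addrC. Qed.

(** Ordered pairs index a spanning family with repetitions rather than a basis; the entries of a
    matrix then serve directly as coefficients. *)
Definition symmx_delta d (i j : 'I_d) : symmx R d :=
  to_symmx (symmx_delta_subproof i j).

Lemma symmx_deltaC d (i j : 'I_d) : symmx_delta i j = symmx_delta j i.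
Proof. by apply: val_inj; rewrite /= addrC. Qed.

Lemma symmx_sum_delta d (X : symmx R d) :
  X = \sum_(ij : 'I_d * 'I_d) (X : 'M_d) ij.1 ij.2 *: symmx_delta ij.1 ij.2.
Proof.
apply: val_inj; rewrite [RHS]linear_sum /=.
rewrite -(pair_bigA _ (fun i j => \val ((X : 'M_d) i j *: symmx_delta i j))) /=.
transitivity (2^-1 *: ((X : 'M_d) + (X : 'M_d)^T)).
  by rewrite symmx_tr -mulr2n -scaler_nat scalerA mulVf ?scale1r// pnatr_eq0.
rewrite {1 2}[X : 'M_d]matrix_sum_delta linear_sum -big_split scaler_sumr.
apply: eq_bigr => i _; rewrite linear_sum -big_split scaler_sumr /=.
apply: eq_bigr => j _.
by rewrite linearZ /= trmx_delta -scalerDr !scalerA mulrC.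
Qed.

(** Self-duality of the psd cone: [T] collects the values of [phi] on the symmetrized matrix units,
    and its form at [u] is [phi (u u^T)]. *)
Lemma psd_functional_trace d (phi : {scalar symmx R d}) :
  (forall X, psd X -> 0 <= phi X) ->
  exists2 T : symmx R d, psd T &
    forall X : symmx R d, phi X = \tr ((T : 'M_d) *m (X : 'M_d)).
Proof.
move=> phi_ge0.
have TE : (\matrix_(i, j) phi (symmx_delta i j))^T =
    \matrix_(i, j) phi (symmx_delta i j).
  by apply/matrixP => i j; rewrite !mxE symmx_deltaC.
have phiE (X : symmx R d) : phi X = \tr ((to_symmx TE : 'M_d) *m (X : 'M_d)).
  rewrite {1}[X]symmx_sum_delta linear_sum.
  rewrite -(pair_bigA _ (fun i j => phi ((X : 'M_d) i j *: symmx_delta i j))) /=.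
  rewrite exchange_big; apply: eq_bigr => i _; rewrite mxE.
  by apply: eq_bigr => j _; rewrite linearZ /= mxE mulrC symmx_deltaC.
exists (to_symmx TE) => // u.
have uE : (u *m u^T)^T = u *m u^T by rewrite trmx_mul trmxK.
have /phi_ge0 : psd (to_symmx uE).
  move=> v; rewrite -/(quad _ _) /= quad_gram quad1.
  by rewrite sumr_ge0// => i _; rewrite sqr_ge0.
by rewrite phiE /= mulmxA mxtrace_mulC mulmxA trace_mx11.
Qed.

(** In the variable [Y] the identity is feasible and an order unit, so [cone_duality] applies to the
    full psd cone. The resulting equality is one of affine functions, valid on the whole affine
    space and not just at psd [Y]. *)
Lemma sdp_duality d n k (A : {linear symmx R d -> 'cV[R]_k}) (b : 'cV[R]_k)
    (Q : 'M[R]_(d, n)) (w : symmx R d -> R) (c : R) :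
  A (congr_symmx Q (symmx1 n)) = b -> affine w ->
  (forall X, spectrahedron A b X -> w X <= c) ->
  exists (T : symmx R n) (mu : R), [/\ psd T, 0 <= mu &
    forall Y, A (congr_symmx Q Y) = b ->
      c - w (congr_symmx Q Y) = \tr ((T : 'M_n) *m (Y : 'M_n)) + mu].
Proof.
set I := symmx1 n => A1 [l [a wE]] wc.
pose N := [set zr : symmx R n * R |
  A (congr_symmx Q zr.1) = 0 /\ zr.2 = - l (congr_symmx Q zr.1)].
have Ipsd : psd I.
  by move=> u; rewrite -/(quad _ _) quad1 sumr_ge0// => i _; rewrite sqr_ge0.
have [||||||z r|phi [phi_ge0 phiI phiN]] := cone_duality
   (b := fun ij : 'I_n * 'I_n => symmx_delta ij.1 ij.2) (K := @psd R n) (N := N)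
   (e := I) (g := c - w (congr_symmx Q I)).
- by move=> Y; eexists; exact: symmx_sum_delta.
- exact: psdD.
- exact: psdZ.
- by split=> /=; rewrite !linear0 ?oppr0.
- move=> t z r z' r' [/= Az ->] [/= Az' ->]; split=> /=.
    by rewrite !linearP /= Az Az' scaler0 addr0.
  by rewrite !linearP /= opprD mulrN.
- exact: psd_unit.
- move=> [/= Az ->] Iz.
  have /wc : spectrahedron A b (congr_symmx Q (I + z)).
    by split; [exact: psd_congr|rewrite !linearD /= A1 Az addr0].
  by rewrite !wE !linearD /=; lra.
have [T Tpsd phiE] := psd_functional_trace phi_ge0.
exists T, (c - w (congr_symmx Q I) - phi I); split=> // [|Y AY].
  by rewrite subr_ge0.
have /phiN : N (Y - I, - l (congr_symmx Q (Y - I))).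
  by split=> //=; rewrite !linearB /= AY A1 subrr.
by rewrite -phiE !wE !linearB /=; lra.
Qed.

End SDPDuality.

(** * Uniform treatment of maximization and minimization *)

Section Senses.
Variables (R : realType) (P : optProblem R).

(** Multiplying objectives and guarantees by this sign reduces both senses to maximization, so
    duality is needed for upper bounds only. *)
Definition sense_sign : R := if opt_sense P is Maximize then 1 else -1.

Lemma sense_signK (x : R) : sense_sign * (sense_sign * x) = x.
Proof. by rewrite /sense_sign; case: opt_sense; lra. Qed.

Lemma no_better_optimumP (T : Type) (D : set T) (w : T -> R) (c : R) :
  no_better P (optimum P D w) c%:E <->
  forall x, D x -> 0 <= sense_sign * (c - w x).
Proof.
rewrite /no_better /optimum /sense_sign; case: opt_sense; split.
- move=> h x Dx; rewrite mul1r subr_ge0 -lee_fin; apply: le_trans h.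
  by apply: ereal_sup_ubound; exists x.
- move=> h; apply: ge_ereal_sup => _ [x Dx <-]; rewrite lee_fin.
  by have := h x Dx; lra.
- move=> h x Dx; rewrite mulN1r opprB subr_ge0 -lee_fin; apply: le_trans h _.
  by apply: ereal_inf_lbound; exists x.
- move=> h; apply: le_ereal_inf_tmp => _ [x Dx <-]; rewrite lee_fin.
  by have := h x Dx; lra.
Qed.

Lemma slack_matrixE (C S : inst P -> R) (f : sound_inst S) (s : sol P) :
  slack_matrix C S f s = sense_sign * (C (val f) - objval s (val f)).
Proof. by rewrite /slack_matrix /sense_sign; case: opt_sense; lra. Qed.

End Senses.

Lemma scalar_affine (R : realType) (V : lmodType R) (l : V -> R) (c : R) :
  scalar l -> affine (fun x => l x + c).
Proof.
move=> llin; pose lL := GRing.isLinear.Build R V R *%R l llin.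
pose l' : {scalar V} := HB.pack l lL.
by exists l', c.
Qed.

Lemma affineZ (R : realType) (V : lmodType R) (w : V -> R) (a : R) :
  affine w -> affine (fun x => a * w x).
Proof.
move=> [l [c wE]]; have := @scalar_affine _ V (fun x => a * l x) (a * c).
have -> : (fun x => a * l x + a * c) = (fun x => a * w x).
  by apply/funext => x; rewrite wE mulrDr.
by apply=> t x y; rewrite linearP /=; lra.
Qed.

(** * Formulations versus factorizations of the slack matrix *)

Section Equivalence.
Variables (R : realType) (P : optProblem R) (C S : inst P -> R).
Notation M := (slack_matrix C S).
Notation sg := (sense_sign P).

Lemma LPformulation_of_factorization (r : nat) :
  LPfactorization M r -> inhabited (LPformulation C S r).
Proof.
move=> [T [U [mu [T0 U0 mu0 ME]]]].
pose A : 'M[R]_r := - 1%:M; pose b : 'cV[R]_r := 0.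
pose x_ (s : sol P) : 'cV[R]_r := \col_k U k s.
(* Solves [M f s = sg * (C - objval)] for the objective value, using [sg * sg = 1], with the
   factorization in place of [M f s]. *)
pose w (f : sound_inst S) (x : 'cV[R]_r) :=
  - sg * (\sum_k T f k * x k 0) + (C (val f) - sg * mu f).
have Ax x i : (A *m x) i 0 = - x i 0 by rewrite mulNmx mul1mx mxE.
have w_obj f s : w f (x_ s) = objval s (val f).
  rewrite /w (_ : \sum_k _ = M f s - mu f); last first.
    by rewrite ME addrK; apply: eq_bigr => k _; rewrite mxE.
  rewrite slack_matrixE; have := sense_signK P (C (val f) - objval s (val f)).
  lra.
exists; apply: (@LPFormulation R P C S r r A b x_ w) => // [s i|f|f].
- by rewrite Ax !mxE oppr_le0.
- apply: scalar_affine => a x y; rewrite mulrCA -mulrDr; congr (_ * _).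
  by rewrite mulr_sumr -big_split; apply: eq_bigr => k _ /=; rewrite !mxE; ring.
- apply/no_better_optimumP => x xP.
  have x0 k : 0 <= x k 0 by have := xP k; rewrite Ax mxE oppr_le0.
  have := sense_signK P (\sum_k T f k * x k 0 + mu f).
  have : 0 <= \sum_k T f k * x k 0 + mu f.
    by rewrite addr_ge0// sumr_ge0// => k _; rewrite mulr_ge0.
  rewrite /w; lra.
Qed.

Lemma factorization_of_LPformulation (m : nat) :
  LPformulation C S m -> LPfactorization M m.
Proof.
move=> [d A b x_ w xP waff wE wbound].
(* Duality needs a feasible point. Without solutions the slack matrix has no columns, and zero
   factors do. *)
have [s0|/forallNP P0] := pselect (exists s : sol P, True); last first.
  by exists (fun _ _ => 0), (fun _ _ => 0), (fun _ => 0); split=> // f s; case: (P0 s).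
have Pne : polyhedron A b !=set0 by case: s0 => s _; exists (x_ s).
have /choice[Tmu TmuP] (f : sound_inst S) : exists Tmu : ('I_m -> R) * R,
    [/\ forall i, 0 <= Tmu.1 i, 0 <= Tmu.2 & forall s,
      M f s = \sum_i Tmu.1 i * (b - A *m x_ s) i 0 + Tmu.2].
  have /no_better_optimumP wb := wbound f.
  have [|T [mu [T0 mu0 TE]]] :=
      lp_duality (c := sg * C (val f)) Pne (affineZ sg (waff f)).
    by move=> x /wb; lra.
  by exists (T, mu); split=> // s; rewrite slack_matrixE -wE mulrBr TE.
exists (fun f => (Tmu f).1), (fun k s => (b - A *m x_ s) k 0), (fun f => (Tmu f).2).
split=> [f|k s|f|f]; try by case: (TmuP f).
exact: polyhedron_slack_ge0.
Qed.

Lemma SDPformulation_of_factorization (r : nat) :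
  SDPfactorization M r -> inhabited (SDPformulation C S r).
Proof.
move=> [T [U [mu [T0 U0 mu0 ME]]]].
pose w (f : sound_inst S) (X : symmx R r) :=
  - sg * \tr ((T f : 'M_r) *m (X : 'M_r)) + (C (val f) - sg * mu f).
have w_obj f s : w f (U s) = objval s (val f).
  rewrite /w (_ : \tr _ = M f s - mu f); last by rewrite ME addrK.
  rewrite slack_matrixE; have := sense_signK P (C (val f) - objval s (val f)).
  lra.
(* No linear constraint is imposed: the map into dimension [0] makes the spectrahedron the whole psd
   cone. *)
exists; apply: (@SDPFormulation R P C S r 0 \0 0 U w) => // [f|f].
- apply: scalar_affine => a X Y; rewrite mulrCA -mulrDr; congr (_ * _).
  by rewrite /= mulmxDr -scalemxAr linearD linearZ.
- apply/no_better_optimumP => X [Xp _].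
  have := sense_signK P (\tr ((T f : 'M_r) *m (X : 'M_r)) + mu f).
  have : 0 <= \tr ((T f : 'M_r) *m (X : 'M_r)) + mu f.
    by rewrite addr_ge0// trace_psd_ge0.
  rewrite /w; lra.
Qed.

Lemma factorization_of_SDPformulation (d : nat) :
  SDPformulation C S d -> SDPfactorization M d.
Proof.
move=> [k A b x_ w xP waff wE wbound].
have psd0 : psd (0 : symmx R d) by move=> u; rewrite mulmx0 mul0mx mxE.
have [s0|/forallNP P0] := pselect (exists s : sol P, True); last first.
  by exists (fun _ => 0), (fun _ => 0), (fun _ => 0); split=> // f s; case: (P0 s).
have [|Q [N [A1 red]]] := @facial_reduction R d k A b.
  by case: s0 => s _; exists (x_ s).
have /choice[Tmu TmuP] (f : sound_inst S) : exists Tmu : symmx R d * R,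
    [/\ psd Tmu.1, 0 <= Tmu.2 & forall s,
      M f s = \tr ((Tmu.1 : 'M_d) *m (congr_symmx N (x_ s) : 'M_d)) + Tmu.2].
  have /no_better_optimumP wb := wbound f.
  have [|T [mu [T0 mu0 TE]]] :=
      sdp_duality (c := sg * C (val f)) A1 (affineZ sg (waff f)).
    by move=> x /wb; lra.
  exists (T, mu); split=> // s.
  (* By facial reduction, [congr_symmx N (x_ s)] is a preimage of [x_ s] under [congr_symmx Q]; it
     becomes the right factor. *)
  have := TE (congr_symmx N (x_ s)); rewrite -(red _ (xP s)) => <-.
    by rewrite slack_matrixE -wE mulrBr.
  by case: (xP s).
exists (fun f => (Tmu f).1), (fun s => congr_symmx N (x_ s)), (fun f => (Tmu f).2).
split=> [f|s|f|f]; try by case: (TmuP f).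
by apply: psd_congr; case: (xP s).
Qed.

End Equivalence.

Theorem theorem3p5 (R : realType) (P : optProblem R) (C S : inst P -> R)
    (hCS : guarantees C S) :
  fc C S = rankLP (slack_matrix C S) /\
  fc_plus C S = rankSDP (slack_matrix C S).
Proof.
(* The two sets of sizes coincide, which also covers the case where both are empty. *)
split; congr (min_size R _); apply/seteqP; split=> r /=.
- by case; exact: factorization_of_LPformulation.
- exact: LPformulation_of_factorization.
- by case; exact: factorization_of_SDPformulation.
- exact: SDPformulation_of_factorization.
Qed.
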